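(* The $K$-adaptability problem with objective uncertainty $$ \begin{array}{cl} \min & \displaystyle\max_{\overline{\boldsymbol\xi}\in\Xi}\ \min_{k\in\mathcal K}\left\{\max_{\boldsymbol\xi\in\Xi(\boldsymbol w,\overline{\boldsymbol\xi})}\ \boldsymbol c^\top\boldsymbol\psi+\boldsymbol\xi^\top\boldsymbol C\boldsymbol x+\boldsymbol\xi^\top\boldsymbol D\boldsymbol w+\boldsymbol\xi^\top\boldsymbol Q\boldsymbol y^k-\boldsymbol\psi^\top\boldsymbol g(\boldsymbol\xi)\right\}\\ \text{s.t.} & \boldsymbol\psi\in\mathbb R_+^{N_g},\ \boldsymbol x\in\mathcal X,\ \boldsymbol w\in\mathcal W,\ \boldsymbol y^k\in\mathcal Y\quad\forall k\in\mathcal K\\ & \boldsymbol T\boldsymbol x+\boldsymbol V\boldsymbol w+\boldsymbol W\boldsymbol y^k\le\boldsymbol h\quad\forall k\in\mathcal K \end{array} $$ is equivalent to the mixed binary bilinear problem $$ \begin{array}{cl} \min & \boldsymbol c^\top\boldsymbol\psi+\boldsymbol b^\top\boldsymbol\beta+\sum_{k\in\mathcal K}\boldsymbol b^\top\boldsymbol\beta^k\\ \text{s.t.} & \boldsymbol x\in\mathcal X,\ \boldsymbol w\in\mathcal W,\ \boldsymbol y^k\in\mathcal Y\ \ \forall k\in\mathcal K\\ & \boldsymbol\alpha\in\mathbb R_+^K,\ \boldsymbol\beta\in\mathbb R_+^R,\ \boldsymbol\beta^k\in\mathbb R_+^R,\ \boldsymbol\gamma^k\in\mathbb R^{N_\xi}\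 \ \forall k\in\mathcal K\\ & \boldsymbol\psi\in\mathbb R_+^{N_g},\ \delta^k_{s,t}\in\mathbb R_+\ \ \forall s\in\mathcal S,\ t\in\mathcal T,\ k\in\mathcal K\\ & \boldsymbol A^\top\boldsymbol\beta^k+\boldsymbol w\circ\boldsymbol\gamma^k+\sum_{s\in\mathcal S}\sum_{t\in\mathcal T}\delta^k_{s,t}\,\boldsymbol g_{st}=\alpha^k(\boldsymbol C\boldsymbol x+\boldsymbol D\boldsymbol w+\boldsymbol Q\boldsymbol y^k)\quad\forall k\in\mathcal K\\ & \sum_{t\in\mathcal T}\boldsymbol\delta^k_t=\alpha^k\boldsymbol\psi\quad\forall k\in\mathcal K\\ & \mathbf e^\top\boldsymbol\alpha=1\\ & \boldsymbol A^\top\boldsymbol\beta=\sum_{k\in\mathcal K}\boldsymbol w\circ\boldsymbol\gamma^k\\ & \boldsymbol T\boldsymbol x+\boldsymbol V\boldsymbol w+\boldsymbol W\boldsymbol y^k\le\boldsymbol h\quad\forall k\in\mathcal K, \end{array} $$ where $\boldsymbol\delta^k_t=(\delta^k_{s,t})_{s\in\mathcal S}\in\mathbb R^{N_g}$. Here equivalent means that the two problems have the same optimal value, and $(\boldsymbol\psi,\boldsymbol x,\boldsymbol w,\{\boldsymbol y^k\}_{k\in\mathcal K})$ is optimal in the first problem if and only if it can be completed to an optimal solution of the second.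
   Context: Data: $K\ge1$ an integer, $\mathcal K=\{1,\dots,K\}$; $\mathcal X\subseteq\mathbb R^{N_x}$, $\mathcal Y\subseteq\mathbb R^{N_y}$ (both may involve integrality constraints), $\mathcal W\subseteq\{0,1\}^{N_\xi}$; matrices $\boldsymbol C\in\mathbb R^{N_\xi\times N_x}$, $\boldsymbol D\in\mathbb R^{N_\xi\times N_\xi}$, $\boldsymbol Q\in\mathbb R^{N_\xi\times N_y}$, $\boldsymbol T\in\mathbb R^{L\times N_x}$, $\boldsymbol V\in\mathbb R^{L\times N_\xi}$, $\boldsymbol W\in\mathbb R^{L\times N_y}$ (deterministic, as there is no uncertainty in the constraints) and $\boldsymbol h\in\mathbb R^L$. $\Xi=\{\boldsymbol\xi\in\mathbb R^{N_\xi}:\boldsymbol A\boldsymbol\xi\le\boldsymbol b\}$, with $\boldsymbol A\in\mathbb R^{R\times N_\xi}$, $\boldsymbol b\in\mathbb R^R$, is a nonempty bounded polyhedron; $\Xi(\boldsymbol w,\overline{\boldsymbol\xi})=\{\boldsymbol\xi\in\Xi:\boldsymbol w\circ\boldsymbol\xi=\boldsymbol w\circ\overline{\boldsymbol\xi}\}$, with $\circ$ the Hadamard (componentwise) product. $\boldsymbol c\in\mathbb R^{N_g}$, and $\boldsymbol g:\mathbb R^{N_\xi}\to\mathbb R^{N_g}$ is given by $g_s(\boldsymbol\xi)=\max_{t\in\mathcal T}\boldsymbol g_{st}^\top\boldsymbol\xi$ for $s\in\mathcal S=\{1,\dots,N_g\}$, $\mathcal T=\{1,\dots,T\}$, $\boldsymbol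 g_{st}\in\mathbb R^{N_\xi}$. $\mathbf e$ is the vector of ones. ''min'' and ''max'' mean infimum and supremum when the optimum is not attained. Standing assumption on the moment data: with $\mathcal P$ the set of nonnegative Borel measures $\mathbb P$ on $\mathbb R^{N_\xi}$ with $\mathbb P(\boldsymbol\xi\in\Xi)=1$ and $\mathbb E_{\mathbb P}(\boldsymbol g(\boldsymbol\xi))\le\boldsymbol c$, there is $\mathbb P\in\mathcal P$ with $\mathbb E_{\mathbb P}[g_s(\boldsymbol\xi)]<c_s$ for all $s$ for which $g_s$ is nonlinear. *)

(* Defs.v *)
From HB Require Import structures.
From mathcomp Require Import all_boot all_order all_algebra.
From mathcomp Require Import all_classical all_reals all_analysis.
Set Implicit Arguments.
Unset Strict Implicit.
Unset Printing Implicit Defensive.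
Import Order.TTheory GRing.Theory Num.Theory.
Import numFieldNormedType.Exports.
Local Open Scope classical_set_scope.
Local Open Scope ring_scope.

Section Vectors.
Context {R : realType}.

Definition dot n (u v : 'cV[R]_n) : R := \sum_(i < n) u i 0 * v i 0.

Definition vec_le n (u v : 'cV[R]_n) : Prop := forall i, u i 0 <= v i 0.

Definition hadamard n (u v : 'cV[R]_n) : 'cV[R]_n := \col_i (u i 0 * v i 0).

Definition binary_vec n (u : 'cV[R]_n) : Prop :=
  forall i, u i 0 = 0 \/ u i 0 = 1.

Definition borel_vec n := g_sigma_algebraType (@open 'cV[R]_n).

End Vectors.
Arguments borel_vec R n : clear implicits.

(* Minimization problems whose optimum need not exist or be attained: the
   optimal value is +oo for an infeasible and -oo for an unbounded problem. *)
Record min_problem (R : realType) (Z : Type) := MinProblem {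
  feasible : set Z ;
  objective : Z -> \bar R }.

Definition optimal_value (R : realType) Z (p : min_problem R Z) : \bar R :=
  ereal_inf (objective p @` feasible p).

Definition is_optimal (R : realType) Z (p : min_problem R Z) (z : Z) : Prop :=
  feasible p z /\
  forall z', feasible p z' -> (objective p z <= objective p z')%E.

(* Dimensions: nx, ny and nxi entries in x, y and xi, nl rows in
   the constraints T x + V w + W y <= h, nr rows in the description A xi <= b
   of the support, ng moment functions, each a maximum of nt linear ones. *)
Record adapt_data (R : realType) (nx ny nxi nl nr ng nt : nat) := AdaptData {
  setX : set 'cV[R]_nx ;
  setY : set 'cV[R]_ny ;
  setW : set 'cV[R]_nxi ;
  matC : 'M[R]_(nxi, nx) ;
  matD : 'M[R]_(nxi, nxi) ;
  matQ : 'M[R]_(nxi, ny) ;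
  matT : 'M[R]_(nl, nx) ;
  matV : 'M[R]_(nl, nxi) ;
  matW : 'M[R]_(nl, ny) ;
  vech : 'cV[R]_nl ;
  matA : 'M[R]_(nr, nxi) ;
  vecb : 'cV[R]_nr ;
  vecc : 'cV[R]_ng ;
  vecg : 'I_ng -> 'I_nt -> 'cV[R]_nxi }.

Record decision (R : realType) (K nx ny nxi ng : nat) := Decision {
  dpsi : 'cV[R]_ng ;
  dx : 'cV[R]_nx ;
  dw : 'cV[R]_nxi ;
  dy : 'I_K -> 'cV[R]_ny }.

(* [ddelta v k t] is the vector (delta^k_{s,t})_s. *)
Record dual_vars (R : realType) (K nxi nr ng nt : nat) := DualVars {
  dalpha : 'cV[R]_K ;
  dbeta : 'cV[R]_nr ;
  dbetak : 'I_K -> 'cV[R]_nr ;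
  dgamma : 'I_K -> 'cV[R]_nxi ;
  ddelta : 'I_K -> 'I_nt -> 'cV[R]_ng }.

Section Problems.
Context {R : realType} {K nx ny nxi nl nr ng nt : nat}.
Context (d : adapt_data R nx ny nxi nl nr ng nt).

Definition Xi : set 'cV[R]_nxi :=
  [set xi | vec_le (matA d *m xi) (vecb d)].

Definition Xi_obs (w xibar : 'cV[R]_nxi) : set 'cV[R]_nxi :=
  [set xi | Xi xi /\ hadamard w xi = hadamard w xibar].

(* The supremum is a maximum when 0 < nt, which is always assumed. *)
Definition gfun (s : 'I_ng) (xi : 'cV[R]_nxi) : R :=
  sup (range (fun t : 'I_nt => dot (vecg d s t) xi)).

Definition gvec (xi : 'cV[R]_nxi) : 'cV[R]_ng := \col_s gfun s xi.

(* The total mass of P outside the support is not prescribed; the expectation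
   of g is required to exist. *)
Definition ambiguity_set : set {measure set (borel_vec R nxi) -> \bar R} :=
  [set P : {measure set (borel_vec R nxi) -> \bar R} | P Xi = 1%E /\
    forall s, P.-integrable setT (fun xi => (gfun s xi)%:E) /\
      (\int[P]_xi (gfun s xi)%:E <= (vecc d s 0)%:E)%E].

Definition moment_slater : Prop :=
  exists2 P, ambiguity_set P &
    forall s, ~ linear (gfun s : 'cV[R]_nxi -> R^o) ->
      (\int[P]_xi (gfun s xi)%:E < (vecc d s 0)%:E)%E.

Definition decision_feasible (z : decision R K nx ny nxi ng) : Prop :=
  [/\ vec_le 0 (dpsi z), setX d (dx z), setW d (dw z),
      forall k, setY d (dy z k) &
      forall k,
        vec_le (matT d *m dx z + matV d *m dw z + matW d *m dy z k) (vech d)].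

Definition scenario_cost (z : decision R K nx ny nxi ng) (k : 'I_K)
    (xi : 'cV[R]_nxi) : R :=
  dot (vecc d) (dpsi z) + dot xi (matC d *m dx z) + dot xi (matD d *m dw z)
  + dot xi (matQ d *m dy z k) - dot (dpsi z) (gvec xi).

Definition adaptability_cost (z : decision R K nx ny nxi ng) : \bar R :=
  ereal_sup [set ereal_inf (range (fun k : 'I_K =>
    ereal_sup [set (scenario_cost z k xi)%:E
              | xi in Xi_obs (dw z) xibar]))
  | xibar in Xi].

Definition adaptability_problem : min_problem R (decision R K nx ny nxi ng) :=
  MinProblem decision_feasible adaptability_cost.

Definition bilinear_feasible
    (zv : decision R K nx ny nxi ng * dual_vars R K nxi nr ng nt) : Prop :=
  let: (z, v) := zv in
  decision_feasible z /\
  [/\ vec_le 0 (dalpha v), vec_le 0 (dbeta v),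
      forall k, vec_le 0 (dbetak v k) &
      forall k t, vec_le 0 (ddelta v k t)] /\
  [/\ forall k,
        (matA d)^T *m dbetak v k + hadamard (dw z) (dgamma v k)
        + \sum_(s < ng) \sum_(t < nt) ddelta v k t s 0 *: vecg d s t
        = dalpha v k 0
          *: (matC d *m dx z + matD d *m dw z + matQ d *m dy z k),
      forall k, \sum_(t < nt) ddelta v k t = dalpha v k 0 *: dpsi z,
      dot (const_mx 1) (dalpha v) = 1 &
      (matA d)^T *m dbeta v = \sum_(k < K) hadamard (dw z) (dgamma v k)].

Definition bilinear_cost
    (zv : decision R K nx ny nxi ng * dual_vars R K nxi nr ng nt) : \bar R :=
  let: (z, v) := zv in
  (dot (vecc d) (dpsi z) + dot (vecb d) (dbeta v)
   + \sum_(k < K) dot (vecb d) (dbetak v k))%:E.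

Definition bilinear_problem :
    min_problem R (decision R K nx ny nxi ng * dual_vars R K nxi nr ng nt) :=
  MinProblem bilinear_feasible bilinear_cost.

End Problems.
Arguments adaptability_problem {R} K {nx ny nxi nl nr ng nt} d.
Arguments bilinear_problem {R} K {nx ny nxi nl nr ng nt} d.

(* Main.v *)
(* For a fixed decision, the worst-case cost is the value of a linear program:
   max-min over finitely many k can be replaced by one maximization over
   (xibar, xi^1, ..., xi^K), and the epigraph variables tau and theta^k
   linearize the minimum over k and the maxima in g. The constraints of the
   bilinear problem on the dual variables are those of the dual program. This
   dual is solvable with zero gap by the Farkas lemma, because the primal is
   feasible and bounded. Minimizing over the decision gives the claim. *)
Require Import Defs.
From mathcomp Require Import all_boot all_order all_algebra.
From mathcomp Require Import all_classical all_reals all_analysis.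
From mathcomp Require Import ring lra.
Set Implicit Arguments.
Unset Strict Implicit.
Unset Printing Implicit Defensive.
Import Order.TTheory GRing.Theory Num.Theory.
Import numFieldNormedType.Exports.
Local Open Scope classical_set_scope.
Local Open Scope ring_scope.

(** * Linear and affine forms of the Farkas lemma *)

Lemma scalar0 (R : realType) (V : lmodType R) (f : V -> R) : scalar f -> f 0 = 0.
Proof. by move=> lf; move: (lf (-1) 0 0); rewrite scaler0 addr0 mulN1r addNr. Qed.

Lemma scalarZ (R : realType) (V : lmodType R) (f : V -> R) (t : R) (x : V) :
  scalar f -> f (t *: x) = t * f x.
Proof. by move=> lf; rewrite -[t *: x]addr0 lf (scalar0 _) ?addr0. Qed.

(* Bartl's induction: if dropping the constraint [a ord0] loses the
   implication, a witness [y] of the loss has [a ord0 y > 0], and projecting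
   along [y] onto the kernel of [a ord0] reduces to the remaining ones. *)
Lemma farkas_ord (R : realType) (V : lmodType R) (m : nat)
    (a : 'I_m -> V -> R) (u : V -> R) :
  (forall i, scalar (a i)) -> scalar u ->
  (forall x, (forall i, a i x <= 0) -> u x <= 0) ->
  exists2 l : 'I_m -> R, (forall i, 0 <= l i) &
    forall x, \sum_i l i * a i x = u x.
Proof.
elim: m a u => [|m IH] a u la lu imp.
  exists (fun=> 0) => // x; rewrite big_ord0; apply/eqP; rewrite eq_le.
  apply/andP; split; last by apply: imp => -[].
  (* Without constraints the implication applies to both [x] and [- x], so [u] vanishes. *)
  have /imp : forall i : 'I_0, a i (- x) <= 0 by case.
  by rewrite -scaleN1r scalarZ // mulN1r oppr_le0.
have [imp'|/existsNP[y /not_implyP[ay /negP]]] :=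
    pselect (forall x, (forall i, a (lift ord0 i) x <= 0) -> u x <= 0).
  have [l l0 lE] := IH _ _ (fun i => la (lift ord0 i)) lu imp'.
  exists (fun i => oapp l 0 (unlift ord0 i)) => [i|x].
    by case: (unlift _ _) => //=.
  rewrite big_ord_recl unlift_none /= mul0r add0r -lE.
  by apply: eq_bigr => i _; rewrite liftK.
rewrite -ltNge => uy; pose a0 := a ord0.
have a0y : 0 < a0 y.
  rewrite ltNge; apply/negP => a0y; suff : u y <= 0 by lra.
  apply: imp => i; case: (unliftP ord0 i) => [j ->|->]; first exact: ay.
  exact: a0y.
pose p x := - (a0 x / a0 y) *: y + x.
have lp (f : V -> R) : scalar f -> scalar (f \o p).
  move=> lf c x z; rewrite /= !lf [a0 _]la -/a0; ring.
have [] := IH (fun i => a (lift ord0 i) \o p) (u \o p).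
- by move=> i; apply: lp.
- exact: lp.
- move=> x apx; apply: imp => i; case: (unliftP ord0 i) => [j ->|->].
    exact: apx.
  by rewrite la -/a0 mulNr divfK ?gt_eqF// addNr.
move=> l l0 lE.
(* The value forced by evaluating the desired identity at [y]. It is nonnegative because [u y] is
   positive and the other constraints are nonpositive at [y]. *)
pose c := (u y - \sum_i l i * a (lift ord0 i) y) / a0 y.
exists (fun i => oapp l c (unlift ord0 i)) => [i|x].
  case: (unlift _ _) => //=; apply: divr_ge0; last exact: ltW.
  rewrite subr_ge0; apply: le_trans (ltW uy).
  by apply: sumr_le0 => j _; apply: mulr_ge0_le0.
rewrite big_ord_recl unlift_none /= -/a0.
have := lE x; rewrite /= lu.
under eq_bigr do rewrite la mulrDr mulrCA.
rewrite big_split /= -mulr_sumr => E.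
under eq_bigr do rewrite liftK /=.
move: E; rewrite /c; set S := \sum_i _ * a _ y; set S' := \sum_i _.
move=> E; have -> : S' = u x + (- (a0 x / a0 y)) * (u y - S) by lra.
by field; rewrite gt_eqF.
Qed.

Lemma farkas (R : realType) (V : lmodType R) (I : finType)
    (a : I -> V -> R) (u : V -> R) :
  (forall i, scalar (a i)) -> scalar u ->
  (forall x, (forall i, a i x <= 0) -> u x <= 0) ->
  exists2 l : I -> R, (forall i, 0 <= l i) &
    forall x, \sum_i l i * a i x = u x.
Proof.
move=> la lu imp.
have [] := @farkas_ord R V #|I| (a \o enum_val) u.
- by move=> i; apply: la.
- exact: lu.
- move=> x ax; apply: imp => i; have := ax (enum_rank i).
  by rewrite /= enum_rankK.
move=> l l0 lE; exists (l \o enum_rank) => [i|x]; first exact: l0.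
rewrite -lE (reindex_onto enum_val enum_rank) /=; last first.
  by move=> i _; rewrite enum_rankK.
by apply: eq_big => i; rewrite enum_valK ?eqxx.
Qed.

(* Farkas in [V * R], with the inequalities homogenized by the second
   coordinate and each equation split into two opposite inequalities. *)
Lemma affine_farkas (R : realType) (V : lmodType R) (I J : finType)
    (a : I -> V -> R) (b : I -> R) (e : J -> V -> R) (u : V -> R) (c : R) :
  (forall i, scalar (a i)) -> (forall j, scalar (e j)) -> scalar u ->
  (exists x, (forall i, a i x <= b i) /\ (forall j, e j x = 0)) ->
  (forall x, (forall i, a i x <= b i) -> (forall j, e j x = 0) -> u x <= c) ->
  exists l : I -> R, exists m : J -> R,
    [/\ forall i, 0 <= l i,
        forall x, \sum_i l i * a i x + \sum_j m j * e j x = u x &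
        \sum_i l i * b i <= c].
Proof.
move=> la le lu [x0 [ax0 ex0]] imp.
pose f (k : 'I_1 + (I + (J + J))) (p : V * R^o) : R := match k with
  | inl _ => - p.2
  | inr (inl i) => a i p.1 - b i * p.2
  | inr (inr (inl j)) => e j p.1
  | inr (inr (inr j)) => - e j p.1
  end.
have [] := @farkas R (V * R^o)%type _ f (fun p => u p.1 - c * p.2).
- move=> [i|[i|[j|j]]] t p q; rewrite /f /=.
  + by rewrite /GRing.scale /=; ring.
  + by rewrite la /GRing.scale /=; ring.
  + exact: le.
  + by rewrite le; ring.
- by move=> t p q /=; rewrite lu /GRing.scale /=; ring.
- move=> [x t] fp; have := fp (inl ord0); rewrite /= oppr_le0 => t0.
  have ap i : a i x <= b i * t by have := fp (inr (inl i)); rewrite /= subr_le0.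
  have ep j : e j x = 0.
    have := fp (inr (inr (inl j))); have := fp (inr (inr (inr j))).
    by rewrite /=; lra.
  have [{}t0|tE] : 0 < t \/ t = 0 by move: t0; rewrite le_eqVlt => /orP[/eqP|]; auto.
    have : u (t^-1 *: x) <= c.
      apply: imp => [i|j]; rewrite scalarZ ?ep ?mulr0 //.
      by rewrite mulrC ler_pdivrMr.
    by rewrite scalarZ // mulrC ler_pdivrMr // subr_le0.
  rewrite tE mulr0 subr0 leNgt; apply/negP => ux.
  (* For [t = 0], [x] is a recession direction. Moving from the feasible [x0] by the step [s] along
     it stays feasible and lifts [u] to at least [c + 1]. *)
  pose s := (1 + `|c - u x0|) / u x.
  have s0 : 0 <= s by rewrite divr_ge0 ?(ltW ux) // addr_ge0.
  have : u (s *: x + x0) <= c.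
    apply: imp => [i|j]; rewrite ?la ?le ?ep ?ex0 ?mulr0 ?addr0 //.
    have := ax0 i; have : s * a i x <= 0.
      by rewrite mulr_ge0_le0 // (le_trans (ap i)) // tE mulr0.
    lra.
  rewrite lu /s divfK ?gt_eqF //; have := ler_norm (c - u x0); lra.
move=> l l0 lE.
exists (fun i => l (inr (inl i))), (fun j => l (inr (inr (inl j))) - l (inr (inr (inr j)))).
have E p : \sum_i l i * f i p = l (inl ord0) * - p.2
   + (\sum_i l (inr (inl i)) * (a i p.1 - b i * p.2)
    + (\sum_j l (inr (inr (inl j))) * e j p.1
    + \sum_j l (inr (inr (inr j))) * - e j p.1)).
  by rewrite !big_sumType big_ord1.
split=> [i|x|] //.
(* The point [(x, 0)] gives the identity on [V]. The point [(0, 1)] gives the bound, with the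
   multiplier of [- t <= 0] as its slack. *)
- rewrite -[RHS]subr0 -(mulr0 c) -(lE (x, 0)) E /= oppr0 !mulr0 add0r.
  congr (_ + _); first by apply: eq_bigr => i _; rewrite mulr0 subr0.
  by rewrite -big_split /=; apply: eq_bigr => j _; rewrite mulrBl mulrN.
- have := lE (0, 1); rewrite E /= (scalar0 lu) mulr1.
  under eq_bigr do rewrite (scalar0 (la _)) mulr1 sub0r mulrN.
  rewrite sumrN.
  have z j t : t * e j 0 = 0 by rewrite (scalar0 (le j)) mulr0.
  have z' j t : t * - e j 0 = 0 by rewrite mulrN z oppr0.
  under [X in _ + (_ + (X + _))]eq_bigr do rewrite z.
  under [X in _ + (_ + (_ + X))]eq_bigr do rewrite z'.
  rewrite !big1_eq.
  have := l0 (inl ord0); lra.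
Qed.

(** * Calculus of the dot product *)

Section Dot.
Context {R : realType}.

Lemma dotC n (u v : 'cV[R]_n) : dot u v = dot v u.
Proof. by apply: eq_bigr => i _; rewrite mulrC. Qed.

Lemma dot_scalar n (v : 'cV[R]_n) : scalar (fun u => dot u v).
Proof.
move=> c x y; rewrite /dot mulr_sumr -big_split /=.
by apply: eq_bigr => i _; rewrite !mxE; ring.
Qed.

Lemma dot0l n (v : 'cV[R]_n) : dot 0 v = 0.
Proof. exact: scalar0 (dot_scalar v). Qed.

Lemma dotDl n (u u' v : 'cV[R]_n) : dot (u + u') v = dot u v + dot u' v.
Proof. by have := dot_scalar v 1 u u'; rewrite scale1r mul1r. Qed.

Lemma dotZl n c (u v : 'cV[R]_n) : dot (c *: u) v = c * dot u v.
Proof. exact: scalarZ (dot_scalar v). Qed.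

Lemma dotNl n (u v : 'cV[R]_n) : dot (- u) v = - dot u v.
Proof. by rewrite -scaleN1r dotZl mulN1r. Qed.

Lemma dotDr n (u v v' : 'cV[R]_n) : dot u (v + v') = dot u v + dot u v'.
Proof. by rewrite dotC dotDl !(dotC u). Qed.

Lemma dotZr n c (u v : 'cV[R]_n) : dot u (c *: v) = c * dot u v.
Proof. by rewrite dotC dotZl (dotC u). Qed.

Lemma dotNr n (u v : 'cV[R]_n) : dot u (- v) = - dot u v.
Proof. by rewrite dotC dotNl (dotC u). Qed.

Lemma dot_sumr n (I : finType) (u : 'cV[R]_n) (F : I -> 'cV[R]_n) :
  dot u (\sum_i F i) = \sum_i dot u (F i).
Proof.
by apply: (big_morph (dot u)); [exact: dotDr|rewrite dotC dot0l].
Qed.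

Lemma dot_mulmx m n (A : 'M[R]_(m, n)) (x : 'cV_n) (y : 'cV_m) :
  dot (A *m x) y = dot x (A^T *m y).
Proof.
rewrite /dot; under eq_bigr do rewrite mxE mulr_suml.
rewrite exchange_big; apply: eq_bigr => i _.
rewrite mxE mulr_sumr; apply: eq_bigr => j _; rewrite !mxE; ring.
Qed.

Lemma dot_hadamard n (u v w : 'cV[R]_n) :
  dot u (hadamard w v) = dot v (hadamard w u).
Proof. by apply: eq_bigr => i _; rewrite !mxE; ring. Qed.

Lemma dot_delta n (i : 'I_n) (v : 'cV[R]_n) : dot (delta_mx i 0) v = v i 0.
Proof.
rewrite /dot (bigD1 i) //= !mxE !eqxx mul1r big1 ?addr0 // => j ji.
by rewrite mxE (negPf ji) mul0r.
Qed.

Lemma dot_eq0 n (v : 'cV[R]_n) : (forall u, dot u v = 0) -> v = 0.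
Proof.
by move=> v0; apply/matrixP => i j; rewrite ord1 -dot_delta v0 mxE.
Qed.

Lemma dot_ler n (u v w : 'cV[R]_n) :
  vec_le u v -> vec_le 0 w -> dot u w <= dot v w.
Proof.
move=> uv w0; apply: ler_sum => i _; apply: ler_wpM2r (uv i).
by have := w0 i; rewrite mxE.
Qed.

Lemma bounded_dot n (A : set 'cV[R]_n) (v : 'cV[R]_n) :
  bounded_set A -> exists M, forall x, A x -> dot x v <= M.
Proof.
move=> /pinfty_ex_gt0[M M0 AM]; exists (\sum_i M * `|v i 0|) => x /AM xM.
apply: ler_sum => i _; apply: le_trans (ler_norm _) _.
rewrite normrM ler_wpM2r //; apply: le_trans xM.
by rewrite [`|x|]mx_normrE (le_bigmax _ (fun ij => `|x ij.1 ij.2|) (i, 0)).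
Qed.

Lemma dot_sum_single (I : finType) n (k : I) (u : 'cV[R]_n) (F : I -> 'cV[R]_n) :
  \sum_i dot (if i == k then u else 0) (F i) = dot u (F k).
Proof.
rewrite (bigD1 k) //= eqxx big1 ?addr0 // => i /negPf ->.
by rewrite dot0l.
Qed.

(** A lower bound uniform in [k], serving in place of the minimum of the scenario costs. *)
Lemma ler_Nsum_norm (I : finType) (f : I -> R) (k : I) :
  - \sum_i `|f i| <= f k.
Proof.
rewrite (bigD1 k) //=; have := ler_norm (- f k); rewrite normrN.
have : 0 <= \sum_(i | i != k) `|f i| by apply: sumr_ge0.
lra.
Qed.

End Dot.

(** * Linear programming duality for a fixed decision *)

Section Costs.
Context {R : realType} {K nx ny nxi nl nr ng nt : nat}.
Context (d : adapt_data R nx ny nxi nl nr ng nt).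

Definition load (z : decision R K nx ny nxi ng) (k : 'I_K) : 'cV[R]_nxi :=
  matC d *m dx z + matD d *m dw z + matQ d *m dy z k.

Lemma scenario_costE (z : decision R K nx ny nxi ng) k xi :
  scenario_cost d z k xi =
  dot (vecc d) (dpsi z) + dot xi (load z k) - dot (dpsi z) (gvec d xi).
Proof. by rewrite /scenario_cost /load !dotDr !addrA. Qed.

Lemma gfun_ub s t xi : dot (vecg d s t) xi <= gfun d s xi.
Proof.
apply: ub_le_sup; last by exists t.
exists (\sum_t `|dot (vecg d s t) xi|) => _ [t' _ <-].
rewrite (bigD1 t') //=; apply: le_trans (ler_norm _) _.
by rewrite lerDl sumr_ge0.
Qed.

(** For [nt = 0] the supremum would be the default value 0, which may exceed [m]. *)
Lemma gfun_le s xi m : (0 < nt)%N ->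
  (forall t, dot (vecg d s t) xi <= m) -> gfun d s xi <= m.
Proof.
move=> nt0 gm; apply: ge_sup => [|_ [t _ <-]]; last exact: gm.
by exists (dot (vecg d s (Ordinal nt0)) xi), (Ordinal nt0).
Qed.

(* The Lagrangian of the linear program
     max tau  s.t.  A xb <= b,  A X_k <= b,  w o X_k = w o xb,
                    tau <= c . psi + X_k . load_k - psi . Th_k,
                    g_st . X_k <= Th_k s,
   whose dual constraints are those of the bilinear problem. *)
Lemma lagrangianE (z : decision R K nx ny nxi ng)
    (v : dual_vars R K nxi nr ng nt) tau xb
    (X : 'I_K -> 'cV[R]_nxi) (Th : 'I_K -> 'cV[R]_ng) :
  dot (matA d *m xb) (dbeta v)
  + \sum_k dot (matA d *m X k) (dbetak v k)
  + \sum_k dalpha v k 0 * (tau - dot (X k) (load z k) + dot (dpsi z) (Th k))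
  + \sum_k \sum_s \sum_t ddelta v k t s 0 * (dot (vecg d s t) (X k) - Th k s 0)
  + \sum_k dot (dgamma v k) (hadamard (dw z) (X k) - hadamard (dw z) xb)
  = dot (const_mx 1) (dalpha v) * tau
  + dot xb ((matA d)^T *m dbeta v - \sum_k hadamard (dw z) (dgamma v k))
  + \sum_k dot (X k) ((matA d)^T *m dbetak v k + hadamard (dw z) (dgamma v k)
        + \sum_(s < ng) \sum_(t < nt) ddelta v k t s 0 *: vecg d s t
        - dalpha v k 0 *: load z k)
  + \sum_k dot (Th k) (dalpha v k 0 *: dpsi z - \sum_t ddelta v k t).
Proof.
rewrite dot_mulmx dotDr dotNr dot_sumr.
have -> : dot (const_mx 1) (dalpha v) * tau = \sum_k dalpha v k 0 * tau.
  by rewrite /dot mulr_suml; apply: eq_bigr => k _; rewrite mxE mul1r.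
(* [B] is common to both sides. All that remains is a sum over [k], so the identity is checked for
   each [k] separately. *)
set B := dot xb _.
suff E k : dot (matA d *m X k) (dbetak v k)
  + dalpha v k 0 * (tau - dot (X k) (load z k) + dot (dpsi z) (Th k))
  + \sum_s \sum_t ddelta v k t s 0 * (dot (vecg d s t) (X k) - Th k s 0)
  + dot (dgamma v k) (hadamard (dw z) (X k) - hadamard (dw z) xb)
  = dalpha v k 0 * tau - dot xb (hadamard (dw z) (dgamma v k))
  + dot (X k) ((matA d)^T *m dbetak v k + hadamard (dw z) (dgamma v k)
        + \sum_(s < ng) \sum_(t < nt) ddelta v k t s 0 *: vecg d s t
        - dalpha v k 0 *: load z k)
  + dot (Th k) (dalpha v k 0 *: dpsi z - \sum_t ddelta v k t).
  have := eq_bigr (op := +%R) (idx := 0) (r := index_enum 'I_K)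
    (P := xpredT) _ (fun k _ => E k).
  by rewrite !big_split /= sumrN; lra.
rewrite dot_mulmx; move: (load z k) => r; rewrite !dotDr !dotNr !dotZr !dot_sumr.
rewrite (dot_hadamard _ (X k)) (dot_hadamard _ xb) (dotC (Th k) (dpsi z)).
have -> : \sum_s \sum_t ddelta v k t s 0 * (dot (vecg d s t) (X k) - Th k s 0)
  = \sum_s dot (X k) (\sum_t ddelta v k t s 0 *: vecg d s t)
    - \sum_t dot (Th k) (ddelta v k t).
  rewrite /(dot (Th k) _) [X in _ - X]exchange_big -sumrB; apply: eq_bigr => s _.
  rewrite dot_sumr -sumrB; apply: eq_bigr => t _.
  by rewrite dotZr (dotC (X k)); ring.
ring.
Qed.


(** Weak duality. If the bilinear cost [c] were exceeded at some [xb], each [k] would have an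
    observable scenario [X k] costing more than [c]. The Lagrangian at [tau = c] and
    [Th k = gvec d (X k)] would then yield [c < c]. Picking strictly costlier scenarios avoids
    attaining the suprema. *)
Lemma adaptability_cost_le (z : decision R K nx ny nxi ng)
    (v : dual_vars R K nxi nr ng nt) :
  bilinear_feasible d (z, v) ->
  (adaptability_cost d z <= bilinear_cost d (z, v))%E.
Proof.
move=> [_ [[a0 b0 bk0 d0] [e1 e2 e3 e4]]].
apply: ge_ereal_sup => _ [xb Axb <-]; rewrite leNgt; apply/negP => lt_inf.
move: lt_inf; rewrite /bilinear_cost.
set c := (X in (X%:E < _)%E) => lt_inf.
have cdef : c = dot (vecc d) (dpsi z) + dot (vecb d) (dbeta v)
  + \sum_k dot (vecb d) (dbetak v k) by [].
clearbody c.
have [X XP] : {X : 'I_K -> 'cV[R]_nxi & forall k,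
    Xi_obs d (dw z) xb (X k) /\ c < scenario_cost d z k (X k)}.
  suff : forall k, exists xi, Xi_obs d (dw z) xb xi /\ c < scenario_cost d z k xi.
    exact: choice.
  move=> k.
  have /ereal_sup_gt[_ [xi Oxi <-]] :=
    lt_le_trans lt_inf (ereal_inf_lbound (ex_intro2 _ _ k I erefl)).
  by rewrite lte_fin => ?; exists xi.
have := lagrangianE z v c xb X (fun k => gvec d (X k)).
(* The dual equations annul every coefficient on the right except that of [tau], which is 1. *)
rewrite e3 mul1r e4 subrr (dotC xb) dot0l addr0.
under [X in _ = _ + X + _]eq_bigr => k _ do
  rewrite (e1 k : _ = _ *: load z k) subrr dotC dot0l.
under [X in _ = _ + X]eq_bigr => k _ do rewrite e2 subrr dotC dot0l.
rewrite !big1_eq !addr0 => cE.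
have lexb := dot_ler Axb b0.
have leX : \sum_k dot (matA d *m X k) (dbetak v k)
    <= \sum_k dot (vecb d) (dbetak v k).
  by apply: ler_sum => k _; apply: dot_ler => //; case: (XP k) => -[].
have led : \sum_k \sum_s \sum_t ddelta v k t s 0 *
    (dot (vecg d s t) (X k) - (gvec d (X k)) s 0) <= 0.
  apply: sumr_le0 => k _; apply: sumr_le0 => s _; apply: sumr_le0 => t _.
  apply: mulr_ge0_le0; first by have := d0 k t s; rewrite mxE.
  by rewrite mxE subr_le0 gfun_ub.
have eqg : \sum_k dot (dgamma v k) (hadamard (dw z) (X k) - hadamard (dw z) xb) = 0.
  by apply: big1 => k _; have [[_ ->] _] := XP k; rewrite subrr dotC dot0l.
have a1 : \sum_k dalpha v k 0 = 1.
  by rewrite -e3; apply: eq_bigr => k _; rewrite mxE mul1r.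
have age0 k : 0 <= dalpha v k 0 by have := a0 k; rewrite mxE.
(* The weights are nonnegative with sum 1, so at least one of the strict inequalities gets a
   positive weight. *)
have lea : 0 < \sum_k dalpha v k 0 * (scenario_cost d z k (X k) - c).
  have ge0 k : 0 <= dalpha v k 0 * (scenario_cost d z k (X k) - c).
    by rewrite mulr_ge0 // subr_ge0 ltW //; case: (XP k).
  rewrite lt_neqAle sumr_ge0 // andbT eq_sym psumr_eq0 //.
  apply/negP => /allP a_eq0; move: a1; rewrite big1 => [/eqP|k _].
    by rewrite eq_sym oner_eq0.
  have := a_eq0 k (mem_index_enum k); rewrite /= mulf_eq0 => /orP[/eqP//|].
  by rewrite subr_eq0 gt_eqF //; case: (XP k).
have aE : \sum_k dalpha v k 0 * (c - dot (X k) (load z k)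
      + dot (dpsi z) (gvec d (X k)))
    = dot (vecc d) (dpsi z)
      - \sum_k dalpha v k 0 * (scenario_cost d z k (X k) - c).
  rewrite -[dot (vecc d) _]mul1r -a1 mulr_suml -sumrB; apply: eq_bigr => k _.
  by rewrite scenario_costE; ring.
move: cE lea; rewrite aE eqg; lra.
Qed.

(** From below, take [x0] both as observation and as scenario. From above, keep only [k0] and
    replace each maximum in [g] by its piece [t0]. As [psi] is nonnegative, this leaves an affine
    upper bound, bounded on the support. *)
Lemma adaptability_cost_fin (z : decision R K nx ny nxi ng) :
  (0 < K)%N -> (0 < nt)%N -> Xi d !=set0 -> bounded_set (Xi d) ->
  vec_le 0 (dpsi z) -> adaptability_cost d z \is a fin_num.
Proof.
move=> K0 nt0 [x0 Ax0] Xb psi0; pose k0 := Ordinal K0; pose t0 := Ordinal nt0.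
rewrite fin_numElt; apply/andP; split.
  pose m := - \sum_k `|scenario_cost d z k x0|.
  apply: (@lt_le_trans _ _ m%:E); first exact: ltNyr.
  apply: le_trans (ereal_sup_ubound (ex_intro2 _ _ x0 Ax0 erefl)).
  apply: le_ereal_inf_tmp => _ [k _ <-].
  apply: (@le_trans _ _ (scenario_cost d z k x0)%:E).
    by rewrite lee_fin /m; apply: ler_Nsum_norm.
  by apply: ereal_sup_ubound; exists x0.
pose G : 'cV[R]_nxi := \sum_s dpsi z s 0 *: vecg d s t0.
have [M MP] := bounded_dot (load z k0 - G) Xb.
apply: (@le_lt_trans _ _ (dot (vecc d) (dpsi z) + M)%:E); last exact: ltry.
apply: ge_ereal_sup => _ [xb Axb <-].
apply: le_trans (ereal_inf_lbound (ex_intro2 _ _ k0 I erefl)) _.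
apply: ge_ereal_sup => _ [xi [Axi _] <-]; rewrite lee_fin scenario_costE.
rewrite -addrA lerD2l; apply: le_trans (MP _ Axi); rewrite dotDr lerD2l dotNr lerN2.
rewrite dot_sumr; apply: ler_sum => s _; rewrite dotZr mxE.
apply: ler_wpM2l; first by have := psi0 s; rewrite mxE.
by rewrite dotC gfun_ub.
Qed.

(** Strong duality: the linear program of [lagrangianE] is feasible and bounded by the worst-case
    cost, so [affine_farkas] supplies multipliers, which are the dual variables sought. *)
Lemma dual_attained (z : decision R K nx ny nxi ng) :
  (0 < K)%N -> (0 < nt)%N -> Xi d !=set0 -> bounded_set (Xi d) ->
  decision_feasible d z ->
  exists v, bilinear_feasible d (z, v) /\
    (bilinear_cost d (z, v) <= adaptability_cost d z)%E.
Proof.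
move=> K0 nt0 Xn Xb zf; have [psi0 _ _ _ _] := zf.
have /fineK := adaptability_cost_fin K0 nt0 Xn Xb psi0.
set c := fine _ => cE; have [x0 Ax0] := Xn.
(* Points are [(tau, xb, X, Th)]. The blocks of [I] are, in order, the support constraints on [xb]
   and on each [X k], the bounds on [tau], and the epigraphs of the pieces of [g]; [e] encodes that
   [X k] and [xb] agree where observed. *)
pose V := (R^o * 'cV[R]_nxi * ('I_K -> 'cV[R]_nxi) * ('I_K -> 'cV[R]_ng))%type.
pose I := ('I_nr + ('I_K * 'I_nr + ('I_K + 'I_K * ('I_ng * 'I_nt))))%type.
pose a (i : I) (p : V) : R := match i with
  | inl j => (matA d *m p.1.1.2) j 0
  | inr (inl (k, j)) => (matA d *m p.1.2 k) j 0
  | inr (inr (inl k)) => p.1.1.1 - dot (p.1.2 k) (load z k) + dot (p.2 k) (dpsi z)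
  | inr (inr (inr (k, (s, t)))) => dot (p.1.2 k) (vecg d s t) - p.2 k s 0
  end.
pose b (i : I) : R := match i with
  | inl j => vecb d j 0
  | inr (inl (k, j)) => vecb d j 0
  | inr (inr (inl k)) => dot (vecc d) (dpsi z)
  | inr (inr (inr _)) => 0
  end.
pose e (i : 'I_K * 'I_nxi) (p : V) : R :=
  (hadamard (dw z) (p.1.2 i.1) - hadamard (dw z) p.1.1.2) i.2 0.
have [] := @affine_farkas R V I _ a b e (fun p => p.1.1.1) c.
- move=> [j|[[k j]|[k|[k [s t]]]]] h p q; rewrite /a /= ?dot_scalar.
  + by rewrite linearP !mxE.
  + by rewrite linearP !mxE.
  + by rewrite /GRing.scale /=; ring.
  + by rewrite !mxE; ring.
- by move=> [k i] h p q; rewrite /e /= !mxE; ring.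
- by [].
- exists (- \sum_k `|scenario_cost d z k x0|, x0, fun=> x0, fun=> gvec d x0).
  split=> [[j|[[k j]|[k|[k [s t]]]]]|[k i]].
  + exact: Ax0.
  + exact: Ax0.
  + have := ler_Nsum_norm (fun k => scenario_cost d z k x0) k.
    by rewrite scenario_costE /a /b /= (dotC (gvec d x0)); lra.
  + by rewrite /a /= mxE subr_le0 dotC gfun_ub.
  + by rewrite /e subrr mxE.
(* Since [Th k] dominates [gvec d (X k)], [tau] is at most the cost of [X k] for every [k], hence at
   most the worst-case cost. *)
- move=> [[[tau xb] X] Th] ap ep; rewrite /= -lee_fin cE.
  have Axb : Xi d xb by move=> j; exact: (ap (inl j)).
  apply: le_trans (ereal_sup_ubound (ex_intro2 _ _ xb Axb erefl)).
  apply: le_ereal_inf_tmp => _ [k _ <-].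
  apply: (@le_trans _ _ (scenario_cost d z k (X k))%:E).
    rewrite lee_fin scenario_costE.
    have : dot (gvec d (X k)) (dpsi z) <= dot (Th k) (dpsi z).
      apply: dot_ler => // s; rewrite mxE; apply: gfun_le => // t.
      by have := ap (inr (inr (inr (k, (s, t))))); rewrite /= subr_le0 dotC.
    by have := ap (inr (inr (inl k))); rewrite /= (dotC (dpsi z)); lra.
  apply: ereal_sup_ubound; exists (X k) => //; split.
    by move=> j; exact: (ap (inr (inl (k, j)))).
  apply/matrixP => i j; rewrite ord1; apply/eqP; rewrite -subr_eq0.
  by have := ep (k, i); rewrite /e !mxE => ->.
move=> l [m [l0 lE lb]].
pose v := @DualVars R K nxi nr ng nt
  (\col_k l (inr (inr (inl k)))) (\col_j l (inl j))
  (fun k => \col_j l (inr (inl (k, j)))) (fun k => \col_i m (k, i))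
  (fun k t => \col_s l (inr (inr (inr (k, (s, t)))))).
(* The Farkas identity says that the Lagrangian equals [tau] at every point. Setting all but one of
   the variables to zero then isolates each dual equation. *)
have L tau xb X Th : dot (const_mx 1) (dalpha v) * tau
    + dot xb ((matA d)^T *m dbeta v - \sum_k hadamard (dw z) (dgamma v k))
    + \sum_k dot (X k) ((matA d)^T *m dbetak v k + hadamard (dw z) (dgamma v k)
        + \sum_(s < ng) \sum_(t < nt) ddelta v k t s 0 *: vecg d s t
        - dalpha v k 0 *: load z k)
    + \sum_k dot (Th k) (dalpha v k 0 *: dpsi z - \sum_t ddelta v k t) = tau.
  rewrite -lagrangianE -[RHS](lE (tau, xb, X, Th)) !big_sumType /=.
  rewrite !addrA; congr (_ + _); first congr (_ + _ + _ + _).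
  - by apply: eq_bigr => j _; rewrite mulrC [in LHS]mxE.
  - rewrite /dot pair_bigA; apply: eq_bigr => -[k j] _ /=.
    by rewrite mulrC [X in X * _ = _]mxE.
  - by apply: eq_bigr => k _; rewrite mxE (dotC (Th k)).
  - under eq_bigr do rewrite pair_bigA.
    rewrite pair_bigA; apply: eq_bigr => -[k [s t]] _ /=.
    by rewrite mxE (dotC (X k)).
  - by rewrite /dot pair_bigA; apply: eq_bigr => -[k i] _; rewrite /= [X in X * _ = _]mxE.
have dot0s n (F : 'I_K -> 'cV[R]_n) : \sum_k dot 0 (F k) = 0.
  by apply: big1 => k _; rewrite dot0l.
have e3 : dot (const_mx 1) (dalpha v) = 1.
  have := L 1 0 (fun=> 0) (fun=> 0).
  by rewrite mulr1 dot0l !dot0s !addr0.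
exists v; split.
  split=> //; split.
    by split=> [k|j|k j|k t s]; rewrite !mxE.
  split=> [k|k|//|].
  - apply/subr0_eq/dot_eq0 => u.
    have := L 0 0 (fun j => if j == k then u else 0) (fun=> 0).
    by rewrite mulr0 dot0l dot_sum_single dot0s !add0r addr0.
  - apply/esym/subr0_eq/dot_eq0 => u.
    have := L 0 0 (fun=> 0) (fun j => if j == k then u else 0).
    by rewrite mulr0 dot0l dot_sum_single dot0s !add0r.
  - apply/subr0_eq/dot_eq0 => u; have := L 0 u (fun=> 0) (fun=> 0).
    by rewrite mulr0 !dot0s add0r !addr0.
rewrite -cE lee_fin; apply: le_trans lb.
rewrite !big_sumType /= [X in _ + (_ + (_ + X))]big1 ?addr0; last first.
  by move=> i _; rewrite mulr0.
rewrite le_eqVlt; apply/orP; left; apply/eqP.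
(* The bounds on [tau] all have the same constant term, which therefore enters the dual objective
   with weight one. *)
have a1 : \sum_k l (inr (inr (inl k))) = 1.
  by rewrite -e3; apply: eq_bigr => k _; rewrite !mxE mul1r.
rewrite -[in RHS]mulr_suml a1 mul1r.
rewrite -addrA addrC -!addrA; congr (_ + (_ + _)).
- by apply: eq_bigr => j _; rewrite mulrC [X in X * _]mxE.
- rewrite /dot pair_bigA; apply: eq_bigr => -[k j] _ /=.
  by rewrite mulrC [X in X * _]mxE.
Qed.

End Costs.

(** * Minimization over the decision *)

Theorem theorem2 (R : realType) (K nx ny nxi nl nr ng nt : nat)
    (d : adapt_data R nx ny nxi nl nr ng nt)
    (hK : (1 <= K)%N) (hnt : (1 <= nt)%N)
    (hW : setW d `<=` [set w | binary_vec w])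
    (hXi0 : Xi d !=set0) (hXib : bounded_set (Xi d))
    (hslater : moment_slater d) :
  optimal_value (adaptability_problem K d) =
    optimal_value (bilinear_problem K d) /\
  forall z : decision R K nx ny nxi ng,
    is_optimal (adaptability_problem K d) z <->
    exists v : dual_vars R K nxi nr ng nt,
      is_optimal (bilinear_problem K d) (z, v).
Proof.
have weak := @adaptability_cost_le R K nx ny nxi nl nr ng nt d.
have strong z := @dual_attained R K nx ny nxi nl nr ng nt d z hK hnt hXi0 hXib.
split.
  apply/eqP; rewrite eq_le; apply/andP; split.
    apply: le_ereal_inf_tmp => _ [[z v] zv <-]; apply: le_trans (weak z v zv).
    by apply: ereal_inf_lbound; exists z => //; case: zv.
  apply: le_ereal_inf_tmp => _ [z zf <-].
  have [v [zv le_vz]] := strong z zf; apply: le_trans le_vz.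
  by apply: ereal_inf_lbound; exists (z, v).
move=> z; split=> [[zf zopt]|[v [zv vopt]]].
  (* An optimal decision is completed by its attained dual solution. *)
  have [v [zv le_vz]] := strong z zf.
  exists v; split=> // -[z' v'] zv'; apply: le_trans le_vz _.
  by apply: le_trans (weak z' v' zv'); apply: zopt; case: zv'.
split=> [|z' zf' /=]; first by case: zv.
(* A competitor [z'] is completed at no extra cost, so that it can be compared with [(z, v)]. *)
have [v' [zv' le_vz']] := strong z' zf'.
apply: le_trans (weak z v zv) _; apply: le_trans le_vz'.
exact: (vopt (z', v') zv').
Qed.
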